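(* If $\ell > 3$ is an odd integer, then no Steiner triple system of order $3\ell-2$ has an $\ell$-good sequencing.
   Context: A Steiner triple system of order $v$ (an STS$(v)$) is a pair $(X,\mathcal{B})$ where $X$ is a set of $v$ points and $\mathcal{B}$ is a set of 3-subsets of $X$ (blocks) such that every pair of distinct points lies in exactly one block. For an integer $\ell \geq 3$, an $\ell$-good sequencing of $(X,\mathcal{B})$ is a permutation $[x_1\, x_2\, \cdots\, x_v]$ of $X$ such that no $\ell$ consecutive points $x_j, x_{j+1},\dots,x_{j+\ell-1}$ of the permutation contain a block of $\mathcal{B}$. *)

(* Defs.v *)
From mathcomp Require Import all_boot.

Set Implicit Arguments.
Unset Strict Implicit.
Unset Printing Implicit Defensive.

(* The point set X of the design is the whole finite type [T]. *)
Definition steiner_triple_system (T : finType) (v : nat) (B : {set {set T}}) : Prop :=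
  [/\ #|T| = v,
      forall b : {set T}, b \in B -> #|b| = 3
    & forall x y : T, x != y ->
        exists! b : {set T}, [/\ b \in B, x \in b & y \in b]].

(* The permutation [x_1 ... x_v] is the list [s] of all points, each occurring
   exactly once; [take l (drop j s)] is the window x_(j+1), ..., x_(j+l).
   Windows do not wrap around. *)
Definition good_sequencing (T : finType) (l : nat) (B : {set {set T}}) (s : seq T) : Prop :=
  perm_eq s (enum T) /\
  forall j : nat, j + l <= size s ->
    forall b : {set T}, b \in B -> ~~ (b \subset take l (drop j s)).

(* Main.v *)
Require Import Defs.
From mathcomp Require Import all_boot.
From mathcomp Require Import zify.

(** Cut the sequencing into a prefix of [h] points and the remaining [v - h].
    A block meeting both sides contains exactly two pairs that cross the cut; a
    block inside one side is too long for a window, so it contains a pair at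
    distance at least [l] on that side.  Hence every block has weight at least
    2 when crossing pairs weigh 1 and long pairs inside a side weigh 2.  Summing
    over the v(v-1)/6 blocks bounds v(v-1)/3 by the total weight of the pairs,
    and cutting v = 6k+1 points (l = 2k+1) after 3k+1 of them forces k <= 1. *)

Definition cut_weight (h l i j : nat) : nat :=
  if (i < h) != (j < h) then 1 else 2 * ((i + l <= j) || (j + l <= i)).

Lemma sum_nat_interval n a b :
  \sum_(i < n) ((a <= i) && (i < b) : nat) = minn n b - a.
Proof.
elim: n => [|n IHn]; first by rewrite big_ord0; lia.
by rewrite big_ord_recr /= IHn; lia.
Qed.

(** The truncated terms vanish for [j < m] and then run through 1, 2, ..., [n - m], a triangular
    number. It is doubled to avoid a division. *)
Lemma sum_succ_sub n m :
  (\sum_(j < n) (j.+1 - m)) * 2 = (n - m) * (n - m).+1.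
Proof.
elim: n => [|n IHn]; first by rewrite big_ord0; lia.
rewrite big_ord_recr /= mulnDl IHn.
case: (leqP m n) => [le_mn | lt_nm]; last by lia.
by rewrite subSn //; nia.
Qed.

(** The [h * r] crossing pairs weigh 1 each, and a side of [n] points has [(n - l) * (n - l).+1 / 2]
    long pairs of weight 2. The factor 2 comes from summing over ordered pairs. *)
Lemma sum_cut_weight h r l : 0 < l ->
  \sum_(i < h + r) \sum_(j < h + r) cut_weight h l i j =
  2 * (h * r + (h - l) * (h - l).+1 + (r - l) * (r - l).+1).
Proof.
move=> l_gt0.
(* [g i j] carries the weight of a pair only when [i] is the earlier position, so the full sum is
   twice the sum of [g], taken below by the later position [j]. *)
pose g i j := ((i < h) && (h <= j)) +
  2 * (((i < h) == (j < h)) && (i + l <= j)).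
have wE i j : cut_weight h l i j = g i j + g j i.
  by rewrite /cut_weight /g; case: (ltnP i h); case: (ltnP j h) => /=; lia.
under eq_bigr do under eq_bigr do rewrite wE.
under eq_bigr do rewrite big_split /=.
rewrite big_split /= exchange_big /= addnn -mul2n; congr (2 * _).
rewrite big_split_ord /=.
have ->: \sum_(j < h) \sum_(i < h + r) g i j = (h - l) * (h - l).+1.
  rewrite -sum_succ_sub big_distrl; apply: eq_bigr => j _.
  rewrite (eq_bigr (fun i : 'I_(h + r) => 2 * ((0 <= i) && (i < j.+1 - l)))).
    by rewrite -big_distrr sum_nat_interval /=; have := ltn_ord j; lia.
  by move=> i _; have := ltn_ord j; rewrite /g; lia.
(* A later position beyond the cut meets all [h] prefix positions in crossing pairs and [j.+1 - l]
   positions of its own side in long pairs. *)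
have E (j : 'I_r) : \sum_(i < h + r) g i (h + j) = h + (j.+1 - l) * 2.
  rewrite (eq_bigr (fun i : 'I_(h + r) =>
    ((0 <= i) && (i < h)) + 2 * ((h <= i) && (i < (h + j).+1 - l)))).
    rewrite big_split -big_distrr !sum_nat_interval /=.
    by have := ltn_ord j; lia.
  by move=> i _; have := ltn_ord j; rewrite /g; lia.
rewrite (eq_bigr _ (fun j _ => E j)) big_split -big_distrl /= sum_succ_sub.
by rewrite sum_nat_const card_ord; lia.
Qed.

(** Double counting: each ordered pair of distinct points lies in exactly one block. *)
Lemma sum_pairs_blocks {T : finType} {v : nat} {B : {set {set T}}}
    (f : T -> T -> nat) : steiner_triple_system v B ->
  \sum_x \sum_(y | x != y) f x y =
  \sum_(b in B) \sum_(x in b) \sum_(y in b | x != y) f x y.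
Proof.
case=> _ _ uniqB.
under [RHS]eq_bigr do rewrite big_mkcond /=.
rewrite exchange_big /=; apply: eq_bigr => x _.
rewrite -big_mkcondr /= (exchange_big_dep (fun y => x != y)) /=; last first.
  by move=> b y _ /andP[].
apply: eq_bigr => y neq_xy.
have [b [[bB xb yb] b_uniq]] := uniqB x y neq_xy.
rewrite (big_pred1 b) // => c; rewrite neq_xy andbT /=.
apply/idP/eqP => [/andP[/andP[cB xc] yc] | ->]; last by rewrite bB xb yb.
by apply/esym/b_uniq.
Qed.

Lemma sum_pairs_card3 {T : finType} {b : {set T}} (f : T -> T -> nat) :
  #|b| = 3 -> exists x y z, b =i [:: x; y; z] /\
    \sum_(u in b) \sum_(t in b | u != t) f u t =
    f x y + f x z + (f y x + f y z) + (f z x + f z y).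
Proof.
have: forall F, \sum_(u in b) F u = \sum_(u <- enum b) F u.
  by move=> F; rewrite big_enum.
rewrite cardE; move: (enum_uniq b) (mem_enum b).
case: (enum b) => [|x [|y [|z []]]] // /and4P[].
rewrite !inE negb_or => /andP[nxy nxz] nyz _ _ mem_b sum_b _.
exists x, y, z; split=> [u|]; first by rewrite -mem_b.
under eq_bigr do rewrite big_mkcondr /=.
rewrite sum_b !big_cons big_nil !sum_b !big_cons !big_nil !eqxx.
by rewrite ![_ == x]eq_sym [z == y]eq_sym nxy nxz nyz /=; lia.
Qed.

Lemma sum_index {T : finType} {s : seq T} (F : nat -> nat) :
  perm_eq s (enum T) -> \sum_x F (index x s) = \sum_(i < size s) F i.
Proof.
move=> s_enum; have s_uniq : uniq s by rewrite (perm_uniq s_enum) enum_uniq.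
rewrite -big_enum -(perm_big _ s_enum) /=.
case: s s_uniq {s_enum} => [|x0 s'] s_uniq; first by rewrite big_nil big_ord0.
rewrite (big_nth x0) big_mkord; apply: eq_bigr => i _.
by rewrite index_uniq.
Qed.

Lemma mem_window (T : eqType) (s : seq T) j l x :
  x \in s -> j <= index x s < j + l -> x \in take l (drop j s).
Proof.
move=> xs /andP[le_j lt_l].
have lt_x : index x s < size s by rewrite index_mem.
have ->: x = nth x (take l (drop j s)) (index x s - j).
  by rewrite nth_take ?nth_drop ?subnKC ?nth_index //; lia.
by rewrite mem_nth // size_take_min size_drop; lia.
Qed.

Lemma good_block_span {T : finType} {l : nat} {B : {set {set T}}} {s : seq T}
    {b : {set T}} (p : nat) :
  l <= size s -> good_sequencing l B s -> b \in B ->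
  ~ {in b, forall u, p <= index u s < p + l}.
Proof.
move=> le_ls [s_enum good] bB close.
have mem_s u : u \in s by rewrite (perm_mem s_enum) mem_enum.
(* The interval starting at [p] may overrun the end of [s]; sliding it back to start at [size s - l]
   gives a genuine window that loses no point of the block. *)
have /negP[] := good (minn p (size s - l)) ltac:(lia) b bB.
apply/subsetP=> u /close /andP[le_pu lt_up]; apply: mem_window => //.
have lt_us : index u s < size s by rewrite index_mem.
by apply/andP; split; lia.
Qed.

Lemma good_sequencing_bound {T : finType} {l : nat} (h r : nat)
    {B : {set {set T}}} {s : seq T} :
  0 < l <= h + r -> steiner_triple_system (h + r) B -> good_sequencing l B s ->
  (h + r) * (h + r).-1 <=
  3 * (h * r + (h - l) * (h - l).+1 + (r - l) * (r - l).+1).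
Proof.
move=> /andP[l_gt0 le_lv] stsB good; have [cardT card3 _] := stsB.
have [s_enum _] := good.
have sz_s : size s = h + r by rewrite (perm_size s_enum) -cardE.
pose w x y := cut_weight h l (index x s) (index y s).
have sum_w : \sum_x \sum_(y | x != y) w x y =
    2 * (h * r + (h - l) * (h - l).+1 + (r - l) * (r - l).+1).
  rewrite -sum_cut_weight // -sz_s.
  rewrite -(sum_index (fun i => \sum_(j < size s) cut_weight h l i j) s_enum).
  apply: eq_bigr => x _; rewrite -(sum_index (cut_weight h l _) s_enum).
  (* The diagonal terms may be included, as they vanish for [0 < l]. *)
  rewrite big_mkcond; apply: eq_bigr => y _; case: eqVneq => //= ->.
  by rewrite /cut_weight eqxx /=; lia.
have sum_2 : \sum_(x : T) \sum_(y | x != y) 2 = 2 * ((h + r) * (h + r).-1).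
  rewrite (eq_bigr (fun=> (h + r).-1 * 2)).
    by rewrite sum_nat_const cardT; lia.
  move=> x _; rewrite sum_nat_const; congr (_ * _).
  rewrite -cardT -(cardC1 x); apply: eq_card => y.
  by rewrite !inE eq_sym.
(* Compared block by block: the six ordered pairs give 12 on the left, and three times twice the
   weight of the block on the right, so weight at least 2 suffices. *)
suff: \sum_(x : T) \sum_(y | x != y) 2 <= 3 * \sum_x \sum_(y | x != y) w x y.
  by rewrite sum_2 sum_w; lia.
rewrite !(sum_pairs_blocks _ stsB) big_distrr; apply: leq_sum => b bB.
have [_ [_ [_ [_ ->]]]] := sum_pairs_card3 (fun _ _ => 2) (card3 b bB).
have [x [y [z [def_b ->]]]] := sum_pairs_card3 w (card3 b bB).
pose far i j := (i + l <= j) || (j + l <= i).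
have : [|| far (index x s) (index y s), far (index x s) (index z s)
            | far (index y s) (index z s)].
  (* Otherwise all three positions lie within [l] consecutive places starting at the smallest
     one. *)
  apply/negPn/negP; rewrite /far => not_far.
  pose p := minn (index x s) (minn (index y s) (index z s)).
  apply: (good_block_span p _ good bB); first by rewrite sz_s.
  by move=> u; rewrite def_b !inE => /or3P[] /eqP->; apply/andP; split; lia.
rewrite /w /cut_weight /far.
move: (index x s) (index y s) (index z s) => i j k far_ijk.
(* If the cut separates the three positions, two pairs cross it; if not, the far pair lies inside
   one side and weighs 2. *)
case: (ltnP i h); case: (ltnP j h); case: (ltnP k h) => //= _ _ _;
by move: far_ijk; case: (leqP (i + l) j); case: (leqP (j + l) i);
   case: (leqP (i + l) k); case: (leqP (k + l) i);
   case: (leqP (j + l) k); case: (leqP (k + l) j).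
Qed.

Theorem theorem2p2 (l : nat) (hl : 3 < l) (hodd : odd l) (T : finType)
    (B : {set {set T}}) (hB : steiner_triple_system (3 * l - 2) B) :
  ~ exists s : seq T, good_sequencing l B s.
Proof.
case=> s good.
have [k def_l] : exists k, l = k.*2.+1 by exists l./2; lia.
have def_v : 3 * l - 2 = (3 * k).+1 + 3 * k by lia.
rewrite def_v in hB.
have := good_sequencing_bound (l := l) (3 * k).+1 (3 * k) ltac:(lia) hB good.
have ->: (3 * k).+1 - l = k by lia.
have ->: 3 * k - l = k.-1 by lia.
(* For positive [k] the bound reads [36k^2 + 6k <= 33k^2 + 9k], that is [k <= 1], whereas [3 < l]
   gives [k >= 2]. *)
by case: k def_l {def_v hB} => [|k] /=; [lia | nia].
Qed.
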